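(* Let $D$ be an associative division algebra finite-dimensional over its center $F$, let $\sigma\in\mathrm{Aut}(D)$ be such that $\sigma|_F$ has finite order $q$, and $F_0=\mathrm{Fix}(\sigma)\cap F$. Let $a\in F_0$ be such that the associative generalized cyclic algebra $A=(D,\sigma,a)$ is a division algebra. Assume $F_0$ contains a primitive $q$th root of unity $\omega$ and let $\tau=H_{\mathrm{id}_D,\omega}:A\to A$. Let $m\ge1$ and suppose there exist $\rho\in\mathrm{Aut}(A)$, $b\in A$ and $1\neq k\in F_0$ such that (1) $\tau$ commutes with $\rho$; (2) $\tau(b)=k\rho(k)\cdots\rho^{m-1}(k)\,b$; (3) $k^q$ is a primitive $m$th root of unity; (4) $t^m-b\in A[t;\rho]$ is irreducible; and (5) the algebra $B=A[t;\rho]/A[t;\rho](t^m-b)$ is either associative, or finite-dimensional over $F_0\cap\mathrm{Fix}(\rho)$, or finite-dimensional over $\mathrm{Nuc}_r(B)$. Then $B$ is a nonassociative cyclic extension of $D$ of degree $mq$ which contains $A$.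
   Context: For an associative division ring $R$ and $\rho\in\mathrm{Aut}(R)$, $R[t;\rho]$ is the twisted polynomial ring (polynomials $\sum a_it^i$, $a_i\in R$, multiplication determined by $ta=\rho(a)t$); for monic $f$ of degree $m$, $R[t;\rho]/R[t;\rho]f$ denotes the set of polynomials of degree $<m$ with multiplication $g\circ h=$ remainder of $gh$ on right division by $f$ (i.e. $gh=qf+r$ uniquely with $\deg r<m$). $(D,\sigma,a)=D[t;\sigma]/D[t;\sigma](t^m-a)$ with the degree of $t^q-a$; for $a\in F_0$ it is associative. $H_{\mathrm{id}_D,\omega}(\sum_{i=0}^{q-1}a_it^i)=a_0+\sum_{i=1}^{q-1}a_i\big(\prod_{l=0}^{i-1}\sigma^l(\omega)\big)t^i$. $f$ is irreducible if not a unit and not a product of two non-units. $\mathrm{Nuc}_r(B)=\{x\in B\mid (yz)x=y(zx)\ \forall y,z\in B\}$. Definition: if $B$ is a nonassociative division algebra (left and right multiplication by every nonzero element bijective) and $D\subseteq B$ an associative division subalgebra, $B$ is a nonassociative cyclic extension of $D$ of degree $s$ if $B$ is a free left $D$-module of rank $s$ and $\mathrm{Aut}(B)$ has a cyclic subgroup $G$ of order $s$ with $H|_D=\mathrm{id}_D$ for all $H\in G$. *)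

(* Defs.v *)
From HB Require Import structures.
From mathcomp Require Import all_boot all_order all_algebra.
Set Implicit Arguments. Unset Strict Implicit. Unset Printing Implicit Defensive.
Import GRing.Theory.
Local Open Scope ring_scope.

Section Generic.
Variables (T : zmodType) (mul : T -> T -> T).

Definition division_alg : Prop :=
  forall x : T, x != 0 -> bijective (mul x) /\ bijective (fun y => mul y x).

Definition associative_alg : Prop :=
  forall x y z : T, mul (mul x y) z = mul x (mul y z).

Definition ring_aut (f : T -> T) : Prop :=
  [/\ bijective f, (forall x y, f (x + y) = f x + f y)
    & (forall x y, f (mul x y) = mul (f x) (f y))].

Definition right_nucleus (x : T) : Prop :=
  forall y z : T, mul (mul y z) x = mul y (mul z x).

Definition fin_dim_left (K : T -> Prop) : Prop :=
  exists (n : nat) (e : 'I_n -> T), forall x : T,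
    exists c : 'I_n -> T, (forall i, K (c i)) /\ x = \sum_(i < n) mul (c i) (e i).

Definition fin_dim_right_nucleus : Prop :=
  exists (n : nat) (e : 'I_n -> T), forall x : T,
    exists c : 'I_n -> T, (forall i, right_nucleus (c i)) /\
      x = \sum_(i < n) mul (e i) (c i).
End Generic.

(* Twisted polynomials R[t;rho] over an associative ring R (carrier R, mult *)
(* mul, automorphism rho), represented as coefficient functions nat -> R.   *)
(* Multiplication: (sum p_i t^i)(sum q_j t^j) = sum p_i rho^i(q_j) t^(i+j). *)
Section Twisted.
Variables (R : zmodType) (mul : R -> R -> R) (rho : R -> R).

Definition tw_mulp (p q : nat -> R) : nat -> R :=
  fun l => \sum_(i < l.+1) mul (p i) (iter i rho (q (l - i)%N)).

Definition tw_one (one : R) : nat -> R := fun l => if l == 0%N then one else 0.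

Definition tw_poly (p : nat -> R) : Prop :=
  exists N, forall l, (N <= l)%N -> p l = 0.

Definition tw_unit (one : R) (p : nat -> R) : Prop :=
  exists u, tw_poly u /\ (forall l, tw_mulp p u l = tw_one one l)
                      /\ (forall l, tw_mulp u p l = tw_one one l).

Definition tw_irreducible (one : R) (f : nat -> R) : Prop :=
  [/\ tw_poly f, ~ tw_unit one f &
    forall g h, tw_poly g -> tw_poly h -> (forall l, f l = tw_mulp g h l) ->
      tw_unit one g \/ tw_unit one h].

Definition tw_binom (one : R) (n : nat) (c : R) : nat -> R :=
  fun l => (if l == n then one else 0) - (if l == 0%N then c else 0).

(* R[t;rho]/R[t;rho](t^n - c): elements are polynomials of degree < n,   *)
(* represented as {ffun 'I_n -> R}.                                      *)
Definition ext n (g : {ffun 'I_n -> R}) (i : nat) : R := oapp g 0 (insub i).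

(* Remainder on right division by t^n - c of a polynomial p of degree    *)
(* < 2n (which is the case of any product g h with deg g, deg h < n):     *)
(* p_(l+n) t^(l+n) = (p_(l+n) t^l)(t^n - c) + p_(l+n) rho^l(c) t^l.       *)
Definition tw_rem n (c : R) (p : nat -> R) : {ffun 'I_n -> R} :=
  [ffun l : 'I_n => p l + mul (p (l + n)%N) (iter l rho c)].

Definition qmul n (c : R) (g h : {ffun 'I_n -> R}) : {ffun 'I_n -> R} :=
  tw_rem n c (tw_mulp (ext g) (ext h)).

Definition cemb n (x : R) : {ffun 'I_n -> R} :=
  [ffun i : 'I_n => if val i == 0%N then x else 0].
End Twisted.
Arguments qmul {R} mul rho n c g h.
Arguments cemb {R} n x.
Arguments tw_rem {R} mul rho n c p.
Arguments ext {R n} g i.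

Definition central (D : unitRingType) (x : D) : Prop := forall y : D, x * y = y * x.

Definition fin_dim_over_center (D : unitRingType) : Prop :=
  exists (n : nat) (e : 'I_n -> D), forall x : D,
    exists c : 'I_n -> D, (forall i, central (c i)) /\ x = \sum_(i < n) c i * e i.

Definition inF0 (D : unitRingType) (sigma : D -> D) (x : D) : Prop :=
  central x /\ sigma x = x.

Definition cycA (D : unitRingType) (sigma : D -> D) (q : nat) (a : D) :=
  @qmul D *%R sigma q a.
Arguments cycA {D} sigma q a.

Definition tauH (D : unitRingType) (sigma : D -> D) (q : nat) (omega : D)
  (x : {ffun 'I_q -> D}) : {ffun 'I_q -> D} :=
  [ffun i : 'I_q => x i * \prod_(l < i) iter l sigma omega].

Definition cycB (D : unitRingType) (sigma : D -> D) (q : nat) (a : D)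
  (rho : {ffun 'I_q -> D} -> {ffun 'I_q -> D}) (m : nat) (b : {ffun 'I_q -> D}) :=
  @qmul {ffun 'I_q -> D} (cycA sigma q a) rho m b.
Arguments cycB {D} sigma q a rho m b.
Arguments tauH {D} sigma q omega x.

Definition nonassoc_cyclic_ext (D : unitRingType) (T : zmodType)
  (mul : T -> T -> T) (one : T) (emb : D -> T) (s : nat) : Prop :=
  [/\
   division_alg mul,
   [/\ injective emb, (forall x y, emb (x + y) = emb x + emb y),
       (forall x y, emb (x * y) = mul (emb x) (emb y)) & emb 1 = one],
   [/\ (forall d d' x, mul (emb d) (mul (emb d') x) = mul (emb (d * d')) x),
       (forall x, mul (emb 1) x = x),
       (forall d x y, mul (emb d) (x + y) = mul (emb d) x + mul (emb d) y)
     & (forall d d' x, mul (emb (d + d')) x = mul (emb d) x + mul (emb d') x)],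
   (exists e : 'I_s -> T,
      (forall x, exists c : 'I_s -> D, x = \sum_(i < s) mul (emb (c i)) (e i)) /\
      (forall c : 'I_s -> D, \sum_(i < s) mul (emb (c i)) (e i) = 0 ->
          forall i, c i = 0))
   &
   (exists H : T -> T,
      [/\ ring_aut mul H, (forall x, iter s H x = x),
          (forall j, (0 < j < s)%N -> exists x, iter j H x != x)
        & (forall d, H (emb d) = emb d)])].

(* Main.v *)
(** Irreducibility of [t^m - b] forces [A] to be associative: a nonzero constant
    [x] is a left factor of [t^m - b], hence has a two-sided inverse, and for
    [x = d t] this gives [sigma^q d = d].  (The bare assumption [a \in F_0] does
    not, since [sigma^q] may be a nontrivial inner automorphism of [D].)

    For [A] associative, if [g h] lies in [A[t;rho] f] with [f = t^m - b]
    irreducible and [deg g, deg h < m], then [f] and [h] are right coprime, and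
    Euclid's algorithm shows that the left cofactor [g] is [0] or of degree at
    least [m].  So [B] has no zero divisors.  Right multiplications are injective
    and linear over [A], left ones over the right nucleus, which is a division
    ring; finite dimension makes both bijective, the three alternatives of (5)
    all yielding finite dimension over the right nucleus.

    The required automorphism is [sum x_i t^i |-> sum tau(x_i) N_i t^i] with
    [N_i = k rho(k) ... rho^(i-1)(k)]: its [j]-th power is trivial only if
    [omega^j = 1] and then [k^j = 1], that is, if [mq] divides [j]. *)
Require Import Defs.
From HB Require Import structures.
From mathcomp Require Import all_boot all_order all_algebra zify.
Set Implicit Arguments. Unset Strict Implicit. Unset Printing Implicit Defensive.
Import GRing.Theory.
Local Open Scope ring_scope.

(** * Spans over a division ring of additive maps *)

Section SpanByMaps.
(** Scalars are maps rather than ring elements, so that one argument serves both left multiplication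
    by constants and right multiplication by the right nucleus. Closure is asked only up to
    pointwise equality, which avoids extensionality of functions. *)
Variables (V : zmodType) (S : (V -> V) -> Prop).
Hypothesis S_id : exists2 s, S s & forall v, s v = v.
Hypothesis SB : forall s u v, S s -> s (u - v) = s u - s v.
Hypothesis S_sub : forall s s', S s -> S s' ->
  exists2 s'', S s'' & forall v, s'' v = s v - s' v.
Hypothesis S_comp : forall s s', S s -> S s' ->
  exists2 s'', S s'' & forall v, s'' v = s (s' v).
Hypothesis S_inv : forall s v, S s -> s v != 0 ->
  exists2 s', S s' & cancel s s'.

Fixpoint span (es : seq V) (v : V) : Prop :=
  if es is e :: es' then exists2 s, S s & span es' (v - s e) else v = 0.

Fixpoint dependent (ws : seq V) : Prop :=
  if ws is w :: ws' then span ws' w \/ dependent ws' else False.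

Let S0 s : S s -> s 0 = 0.
Proof. by move=> Ss; rewrite -[in LHS](subrr 0) SB // subrr. Qed.

Let S_zero : exists2 s, S s & forall v, s v = 0.
Proof.
case: S_id => s Ss sE; case: (S_sub Ss Ss) => t St tE.
by exists t => // v; rewrite tE subrr.
Qed.

Let span0 es : span es 0.
Proof.
elim: es => //= e es IH; case: S_zero => s Ss s0.
by exists s => //; rewrite s0 subr0.
Qed.

Let span_sub es u v : span es u -> span es v -> span es (u - v).
Proof.
elim: es u v => [|e es IH] u v /=; first by move=> -> ->; rewrite subrr.
case=> s Ss Hu [s' Ss' Hv]; case: (S_sub Ss Ss') => t St tE.
exists t => //; rewrite tE.
have -> : u - v - (s e - s' e) = (u - s e) - (v - s' e).
  by rewrite !opprD !opprK addrACA.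
exact: IH.
Qed.

Let span_add es u v : span es u -> span es v -> span es (u + v).
Proof.
move=> Hu Hv; rewrite -[v]opprK -[- v]sub0r.
by apply: (span_sub Hu); apply: span_sub.
Qed.

Let span_scale es s v : S s -> span es v -> span es (s v).
Proof.
move=> Ss; elim: es v => [|e es IH] v /=; first by move=> ->; exact: S0.
case=> s' Ss' /IH H; case: (S_comp Ss Ss') => t St tE.
by exists t => //; rewrite tE -SB.
Qed.

Let span_cons e es v : span es v -> span (e :: es) v.
Proof. by move=> H /=; case: S_zero => s Ss s0; exists s => //; rewrite s0 subr0. Qed.

Let span_mem es v : v \in es -> span es v.
Proof.
elim: es => // e es IH; rewrite in_cons => /orP[/eqP ->|/IH /span_cons //].
by case: S_id => s Ss sE; exists s => //; rewrite sE subrr.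
Qed.

(** The pivot is the last vector whose chosen coefficient at [e] is nonzero. Since [dependent]
    compares a vector with later ones only, the vectors before the pivot may be changed by multiples
    of it. *)
Let pivot e es ws : (forall w, w \in ws -> span (e :: es) w) ->
  (forall w, w \in ws -> span es w) \/
  exists ws1 w ws2, [/\ ws = ws1 ++ w :: ws2, forall w, w \in ws2 -> span es w
    & exists s, [/\ S s, s e != 0 & span es (w - s e)]].
Proof.
elim: ws => [|w ws IH] H; first by left.
have [|{}IH|[ws1 [w1 [ws2 [-> H2 H3]]]]] := IH.
- by move=> w' Hw'; apply: H; rewrite in_cons Hw' orbT.
- have [s Ss Hs] := H w (mem_head _ _).
  have [se0|se0] := eqVneq (s e) 0; last first.
    by right; exists [::], w, ws; split=> //; exists s.
  left=> w'; rewrite in_cons => /orP[/eqP ->|/IH //].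
  by rewrite se0 subr0 in Hs.
- by right; exists (w :: ws1), w1, ws2.
Qed.

(** Gaussian elimination: if [v] has coefficient [r] at [e], subtracting [r (s' w)], where [s']
    undoes [s], cancels [r e]. Dependences pull back because the pivot stays behind the vectors it
    modifies. *)
Let eliminate e es ws1 w ws2 s :
  S s -> s e != 0 -> span es (w - s e) ->
  (forall v, v \in ws1 -> span (e :: es) v) ->
  exists ws1', [/\ size ws1' = size ws1, forall v, v \in ws1' -> span es v,
    forall v, span (ws1' ++ ws2) v -> span (ws1 ++ w :: ws2) v
    & dependent (ws1' ++ ws2) -> dependent (ws1 ++ w :: ws2)].
Proof.
move=> Ss se0 Hw; have [s' Ss' s'K] := S_inv Ss se0.
elim: ws1 => [|v ws1 IH] H.
  by exists [::]; split=> // [v|]; [apply: span_cons | right].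
have [|ws1' [sz1 H1 H2 H3]] := IH.
  by move=> u Hu; apply: H; rewrite in_cons Hu orbT.
have [r Sr Hr] := H v (mem_head _ _).
have [t St tE] := S_comp Sr Ss'.
have Hwm : span (ws1 ++ w :: ws2) w.
  by apply: span_mem; rewrite mem_cat mem_head orbT.
exists (v - t w :: ws1'); split=> /=; first by rewrite sz1.
- move=> u; rewrite in_cons => /orP[/eqP ->|/H1 //].
  have -> : v - t w = (v - r e) - t (w - s e).
    by rewrite SB // (tE (s e)) s'K opprB addrA subrK.
  by apply: span_sub => //; apply: span_scale.
- move=> u [x Sx Hx]; exists x => //.
  have -> : u - x v = (u - x (v - t w)) - x (t w).
    by rewrite SB // opprB addrA addrAC addrK.
  by apply: span_sub; [apply: H2 | do 2 ![apply: span_scale => //]].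
- case=> [/H2 Hv|/H3]; [left | by right].
  by rewrite -[v](subrK (t w)); apply: span_add => //; apply: span_scale.
Qed.

(** Exchange argument: each elimination removes one generator and one vector, which keeps the
    inequality between the lengths. *)
Lemma steinitz es ws : (forall w, w \in ws -> span es w) ->
  (size es < size ws)%N -> dependent ws.
Proof.
elim: es ws => [|e es IH] ws H /= sz.
  case: ws H sz => // w ws H _; left.
  by rewrite (H w (mem_head _ _)); apply: span0.
case: (pivot H) => [{}H|[ws1 [w [ws2 [Ews H2 [s [Ss se0 Hw]]]]]]].
  by apply: IH => //; apply: ltn_trans sz.
have [|ws1' [sz1 H1 _]] := @eliminate e es ws1 w ws2 s Ss se0 Hw.
  by move=> v Hv; apply: H; rewrite Ews mem_cat Hv.
rewrite Ews; apply; apply: IH.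
  by move=> v; rewrite mem_cat => /orP[/H1|/H2].
by move: sz; rewrite Ews !size_cat sz1 /= addnS ltnS.
Qed.

Lemma span_sum (I : Type) (r : seq I) (e : I -> V) (s : I -> V -> V) :
  (forall i, S (s i)) -> span (map e r) (\sum_(i <- r) s i (e i)).
Proof.
move=> Ss; elim: r => [|i r IH]; first by rewrite big_nil.
by rewrite big_cons /=; exists (s i) => //; rewrite addrC addKr.
Qed.

Variable phi : V -> V.
Hypothesis phiB : forall u v, phi (u - v) = phi u - phi v.
Hypothesis phiS : forall s v, S s -> phi (s v) = s (phi v).
Hypothesis phi_eq0 : forall v, phi v = 0 -> v = 0.

Let phi0 : phi 0 = 0.
Proof. by rewrite -[in LHS](subrr 0) phiB subrr. Qed.

Let span_map_image ws v : span (map phi ws) v -> exists u, v = phi u.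
Proof.
elim: ws v => [|w ws IH] v /=; first by move=> ->; exists 0.
case=> s Ss /IH[u Hu]; exists (u - s (- w)).
rewrite phiB -Hu phiS // -[- w]sub0r phiB phi0 SB // S0 // !sub0r opprK.
by rewrite subrK.
Qed.

Let span_map_inv ws w : span (map phi ws) (phi w) -> span ws w.
Proof.
elim: ws w => [|e ws IH] w /=; first exact: phi_eq0.
by case=> s Ss; rewrite -phiS // -phiB => /IH; exists s.
Qed.

Let dependent_map_inv ws : dependent (map phi ws) -> dependent ws.
Proof.
elim: ws => //= w ws IH [/span_map_inv|/IH]; [by left|by right].
Qed.

(** With [n] generators, the [n+1] vectors [v], [phi v], ..., [phi^n v] are dependent. If the
    dependence starts at [phi^i v], injectivity strips [phi] from it [i] times, leaving [v] as a
    combination of images of [phi]. *)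
Lemma injective_surjective es :
  (forall v, span es v) -> forall v, exists u, v = phi u.
Proof.
move=> H v; have {H}: dependent (traject phi v (size es).+1).
  by apply: (@steinitz es) => [w _|]; rewrite ?size_traject.
elim: (size es).+1 => //= n IH.
have -> : traject phi (phi v) n = map phi (traject phi v n).
  by elim: n v {IH} => //= n IHn u; rewrite IHn.
by case=> [/span_map_image|/dependent_map_inv/IH].
Qed.
End SpanByMaps.

(** * Twisted polynomials *)

Section TwistedPolynomials.
Variables (R : nzRingType) (rho : {rmorphism R -> R}).

Lemma iter_rmorph0 i : iter i rho 0 = 0.
Proof. by elim: i => //= i ->; rewrite rmorph0. Qed.

Lemma iter_rmorphM i : {morph iter i rho : x y / x * y}.
Proof. by move=> x y; elim: i => //= i ->; rewrite rmorphM. Qed.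

Lemma iter_rmorph1 i : iter i rho 1 = 1.
Proof. by elim: i => //= i ->; rewrite rmorph1. Qed.

(** This is left multiplication by t, as t p = rho(p) t; on the right, powers of t act as ordinary
    powers of ['X]. *)
Definition shiftp (p : {poly R}) : {poly R} := map_poly rho p * 'X.

Definition twp (p q : {poly R}) : {poly R} :=
  \sum_(i < size p) p`_i *: iter i shiftp q.

Let shiftpB : {morph shiftp : p q / p - q}.
Proof. by move=> p q; rewrite /shiftp rmorphB mulrBl. Qed.

Let shiftp_is_zmod : zmod_morphism shiftp := shiftpB.

HB.instance Definition _ :=
  GRing.isZmodMorphism.Build {poly R} {poly R} shiftp shiftp_is_zmod.

Lemma shiftpZ c p : shiftp (c *: p) = rho c *: shiftp p.
Proof. by rewrite /shiftp map_polyZ scalerAl. Qed.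

Lemma coef_iter_shiftp i q l :
  (iter i shiftp q)`_l = if (l < i)%N then 0 else iter i rho q`_(l - i).
Proof.
elim: i l => [|i IH] l /=; first by rewrite subn0.
rewrite /shiftp coefMX; case: l => //= l.
by rewrite coef_map IH ltnS subSS; case: ifP => _ //; exact: (rmorph0 rho).
Qed.

Lemma iter_shiftpB i : {morph iter i shiftp : p q / p - q}.
Proof. by move=> p q; elim: i => //= i ->; rewrite raddfB. Qed.

Lemma twp_wide n (p q : {poly R}) : (size p <= n)%N ->
  twp p q = \sum_(i < n) p`_i *: iter i shiftp q.
Proof.
move=> le_p_n; rewrite /twp (big_ord_widen n (fun i => p`_i *: iter i shiftp q)) //.
rewrite [RHS](bigID (fun i : 'I_n => (i < size p)%N)) /= [X in _ + X]big1 ?addr0 //.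
by move=> i; rewrite -leqNgt => /(nth_default 0) ->; rewrite scale0r.
Qed.

(** Bridge between [{poly R}], where sizes and leading coefficients are at hand, and the coefficient
    functions of the definitions. *)
Lemma coef_twp (p q : {poly R}) l : (twp p q)`_l = tw_mulp *%R rho (nth 0 p) (nth 0 q) l.
Proof.
rewrite (twp_wide (n := maxn (size p) l.+1)) ?leq_maxl // coef_sum /tw_mulp.
rewrite (big_ord_widen (maxn (size p) l.+1)
  (fun i => p`_i * iter i rho q`_(l - i))) ?leq_maxr //.
rewrite [RHS]big_mkcond; apply: eq_bigr => i _.
by rewrite coefZ coef_iter_shiftp [(i < l.+1)%N]ltnS; case: leqP; rewrite ?mulr0.
Qed.

Lemma twpBr p q r : twp p (q - r) = twp p q - twp p r.
Proof. by rewrite /twp -sumrB; apply: eq_bigr => i _; rewrite iter_shiftpB scalerBr. Qed.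

Lemma twpBl (p q r : {poly R}) : twp (p - q) r = twp p r - twp q r.
Proof.
pose n := maxn (size p) (size q).
have szB : (size (p - q)%R <= n)%N.
  by apply: leq_trans (size_polyD _ _) _; rewrite size_polyN.
rewrite (twp_wide _ szB) (twp_wide (n := n) (p := p)) ?leq_maxl //.
rewrite (twp_wide (n := n) (p := q)) ?leq_maxr //.
by rewrite -sumrB; apply: eq_bigr => i _; rewrite coefB scalerBl.
Qed.

Lemma twp0 p : twp p 0 = 0.
Proof. by rewrite -[in LHS](subrr 0) twpBr subrr. Qed.

Lemma tw0p p : twp 0 p = 0.
Proof. by rewrite -[in LHS](subrr 0) twpBl subrr. Qed.

Lemma twpDr p q r : twp p (q + r) = twp p q + twp p r.
Proof. by rewrite -[r]opprK twpBr -[in RHS]sub0r twpBr twp0 sub0r. Qed.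

Lemma twpDl p q r : twp (p + q) r = twp p r + twp q r.
Proof. by rewrite -[q]opprK twpBl -[in RHS]sub0r twpBl tw0p sub0r. Qed.

Lemma twp_suml I (s : seq I) (F : I -> {poly R}) r :
  twp (\sum_(i <- s) F i) r = \sum_(i <- s) twp (F i) r.
Proof. by apply: (big_morph (twp^~ r)) => [p q|]; rewrite ?twpDl ?tw0p. Qed.

Lemma twpZl c (p q : {poly R}) : twp (c *: p) q = c *: twp p q.
Proof.
rewrite (twp_wide (n := size p)) ?size_scale_leq // /twp scaler_sumr.
by apply: eq_bigr => i _; rewrite coefZ scalerA.
Qed.

Lemma tw1p p : twp 1 p = p.
Proof. by rewrite /twp size_poly1 big_ord1 coef1 /= scale1r. Qed.

Lemma coef_shiftp p l : (shiftp p)`_l = if l is l'.+1 then rho p`_l' else 0.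
Proof. by rewrite /shiftp coefMX; case: l => //= l; rewrite coef_map. Qed.

Lemma twp_shiftpl (p q : {poly R}) : twp (shiftp p) q = shiftp (twp p q).
Proof.
rewrite (twp_wide (n := (size p).+1)); last first.
  apply/leq_sizeP => l ltl; rewrite coef_shiftp; case: l ltl => // l ltl.
  by rewrite (nth_default _ ltl) rmorph0.
rewrite big_ord_recl coef_shiftp scale0r add0r [twp p q]/twp raddf_sum.
by apply: eq_bigr => i _; rewrite [RHS]shiftpZ coef_shiftp.
Qed.

Lemma twp_iter_shiftpl i p q :
  twp (iter i shiftp p) q = iter i shiftp (twp p q).
Proof. by elim: i => //= i <-; rewrite twp_shiftpl. Qed.

(** Left multiplication by p is a sum of scaled powers of [shiftp], and right multiplication by r
    commutes with scaling and with [shiftp]. *)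
Lemma twpA p q r : twp (twp p q) r = twp p (twp q r).
Proof.
rewrite {2}/twp twp_suml; apply: eq_bigr => i _.
by rewrite twpZl twp_iter_shiftpl.
Qed.

Lemma twpX p n : twp p 'X^n = p * 'X^n.
Proof.
rewrite /twp -[in RHS](coefK p) poly_def mulr_suml.
apply: eq_bigr => i _; rewrite -scalerAl; congr (_ *: _).
elim: (nat_of_ord i) => [|j IH] /=; first by rewrite mul1r.
by rewrite IH -!exprD /shiftp map_polyXn -exprSr addSn.
Qed.

Lemma coef_twpC p c l : (twp p c%:P)`_l = p`_l * iter l rho c.
Proof.
rewrite coef_twp /tw_mulp big_ord_recr /= subnn coefC eqxx big1 ?add0r // => i _.
by rewrite coefC subn_eq0 leqNgt ltn_ord /= iter_rmorph0 mulr0.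
Qed.

Hypothesis rho_inj : injective rho.
Hypothesis R_domain : forall x y : R, x * y = 0 -> x = 0 \/ y = 0.

Lemma iter_rho_eq0 i x : iter i rho x = 0 -> x = 0.
Proof. by elim: i => //= i IH H; apply/IH/rho_inj; rewrite rmorph0. Qed.

(** The top coefficient is p_a rho^a(q_b), nonzero because rho is injective and R has no zero
    divisors. *)
Lemma size_twp (p q : {poly R}) : p != 0 -> q != 0 ->
  size (twp p q) = (size p + size q).-1.
Proof.
move=> p0 q0.
have sp : (0 < size p)%N by rewrite size_poly_gt0.
have sq : (0 < size q)%N by rewrite size_poly_gt0.
set n := (_ + _).-1; apply/eqP; rewrite eqn_leq; apply/andP; split.
  apply/leq_sizeP => l ltl; rewrite coef_twp /tw_mulp big1 // => i _.
  have [lei|lti] := leqP (size p) i; first by rewrite nth_default ?mul0r.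
  rewrite [q`__]nth_default ?iter_rmorph0 ?mulr0 //.
  rewrite leq_subRL; last by rewrite -ltnS.
  apply: leq_trans ltl; rewrite /n -ltnS prednK ?addn_gt0 ?sp //.
  by rewrite ltn_add2r.
have [a Ea] : exists a, size p = a.+1 by exists (size p).-1; rewrite prednK.
have [b Eb] : exists b, size q = b.+1 by exists (size q).-1; rewrite prednK.
have top : (twp p q)`_(a + b) = p`_a * iter a rho q`_b.
  have lta : (a < (a + b).+1)%N by rewrite ltnS leq_addr.
  rewrite coef_twp /tw_mulp (bigD1 (Ordinal lta)) //= addKn big1 ?addr0 // => i.
  rewrite -val_eqE /= neq_ltn => /orP[lti|lti].
    rewrite [q`__]nth_default ?iter_rmorph0 ?mulr0 //.
    by rewrite Eb ltn_subRL ltn_add2r.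
  by rewrite nth_default ?mul0r // Ea.
rewrite /n Ea Eb addSn addnS /= ltnNge; apply/negP => /leq_sizeP/(_ _ (leqnn _)).
rewrite top => /R_domain[|/iter_rho_eq0] /eqP.
  by rewrite -[a]/(a.+1.-1) -Ea -lead_coefE lead_coef_eq0 (negPf p0).
by rewrite -[b]/(b.+1.-1) -Eb -lead_coefE lead_coef_eq0 (negPf q0).
Qed.

Lemma twp_eq0 p q : twp p q = 0 -> p = 0 \/ q = 0.
Proof.
have [->|p0] := eqVneq p 0; first by left.
have [->|q0] := eqVneq q 0; first by right.
move=> /(congr1 (size \o @polyseq R))/= /eqP; rewrite size_twp // size_poly0 -subn1 subn_eq0.
move: p0 q0; rewrite -!size_poly_gt0.
by case: (size p) (size q) => // a [//|b]; rewrite addnS addSn.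
Qed.
End TwistedPolynomials.

(** * Right division and Euclid's algorithm *)

Section RightDivision.
Variables (R : nzRingType) (rho : {rmorphism R -> R}).
Hypothesis rho_inj : injective rho.
Hypothesis R_inv : forall x : R, x != 0 -> exists y, y * x = 1.

Lemma division_ring_domain (x y : R) : x * y = 0 -> x = 0 \/ y = 0.
Proof.
have [->|/R_inv[z zx] xy0] := eqVneq x 0; [by left|right].
by rewrite -[y]mul1r -zx -mulrA xy0 mulr0.
Qed.
Let R_domain := division_ring_domain.

(** Long division: a left inverse [y] of rho^k applied to the leading coefficient of f, with k the
    difference of the sizes, makes the leading terms of h and [twp rho u f] agree. *)
Lemma twp_divr (h f : {poly R}) : f != 0 -> exists s r,
  h = twp rho s f + r /\ (size r < size f)%N.
Proof.
move=> f0; have sf : (0 < size f)%N by rewrite size_poly_gt0.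
have [n] := ubnP (size h); elim: n h => // n IH h; rewrite ltnS => szh.
have [lthf|lefh] := ltnP (size h) (size f).
  by exists 0, h; rewrite tw0p add0r.
pose k := (size h - size f)%N.
have [y yK] : exists y, y * iter k rho (lead_coef f) = 1.
  apply: R_inv; apply: contraNneq f0 => /(iter_rho_eq0 rho_inj)/eqP.
  by rewrite lead_coef_eq0.
pose u := (lead_coef h * y) *: 'X^k.
have uE : twp rho u f = (lead_coef h * y) *: iter k (shiftp rho) f.
  rewrite /u twpZl; congr (_ *: _).
  rewrite /twp size_polyXn big_ord_recr /= coefXn eqxx scale1r big1 ?add0r //.
  by move=> i _; rewrite coefXn ltn_eqF // scale0r.
have szh1 : (size (h - twp rho u f)%R < size h)%N.
  have sh : (0 < size h)%N by apply: leq_trans lefh.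
  rewrite -[X in (_ < X)%N]prednK // ltnS; apply/leq_sizeP => l lel.
  rewrite coefB uE coefZ coef_iter_shiftp.
  have lekl : (k <= l)%N.
    by apply: leq_trans lel; rewrite -ltnS prednK // ltn_subrL sf.
  rewrite ltnNge lekl /=; move: lel; rewrite leq_eqVlt => /orP[/eqP <-|ltl].
    have -> : ((size h).-1 - k)%N = (size f).-1.
      by rewrite /k -!subn1 subnAC subKn.
    by rewrite -!lead_coefE -mulrA yK mulr1 subrr.
  rewrite prednK // in ltl.
  rewrite [h`__]nth_default // [f`__]nth_default ?iter_rmorph0 ?mulr0 ?subr0 //.
  by rewrite leq_subRL // /k subnK.
have [|s [r [Er szr]]] := IH (h - twp rho u f); first exact: leq_trans szh1 szh.
exists (s + u), r; split=> //.
by rewrite twpDl addrAC -Er subrK.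
Qed.

(* Euclid's algorithm on (f, h): each division step turns the relation
   [x h = y f] into one for (f, r) with the same [x]. *)
Lemma coprime_size_cofactor (f h x y : {poly R}) :
  (forall d e e', f = twp rho e d -> h = twp rho e' d -> (size d <= 1)%N) ->
  f != 0 -> x != 0 -> twp rho x h = twp rho y f -> (size f <= size x)%N.
Proof.
have [n] := ubnP (size f + size h).
elim: n f h x y => // n IH f h x y; rewrite ltnS => szfh cop f0 x0 E.
(* Reduction of the longer polynomial modulo the shorter one, stated for arbitrary arguments because
   it is used for (f, h) and for (h, f). *)
have step (f' h' x' y' : {poly R}) : (size f' + size h' <= n)%N -> (size f' <= size h')%N ->
    (forall d e e', f' = twp rho e d -> h' = twp rho e' d -> (size d <= 1)%N) ->
    f' != 0 -> x' != 0 -> twp rho x' h' = twp rho y' f' -> (size f' <= size x')%N.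
  move=> sz le cop' f'0 x'0 E'; have [s [r [Eh szr]]] := twp_divr h' f'0.
  apply: (IH f' r x' (y' - twp rho x' s)) => //.
  - by apply: leq_trans sz; rewrite ltn_add2l; apply: leq_trans le.
  - move=> d e e' Ef Er; apply: (cop' d e (twp rho s e + e')) => //.
    by rewrite twpDl twpA -Ef -Er.
  - by rewrite twpBl twpA -E' Eh twpDr addrC addKr.
have [le|lt] := leqP (size f) (size h); first exact: (step f h x y).
(* If h = 0, then f itself is a common right divisor, hence of size at most 1. *)
have [h0|h0] := eqVneq h 0.
  apply: leq_trans (_ : 1 <= _)%N; last by rewrite size_poly_gt0.
  by apply: (cop f 1 0); rewrite ?tw1p ?tw0p.
have y0 : y != 0.
  apply: contraNneq h0 => y0; move: E; rewrite y0 tw0p.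
  by case/(twp_eq0 rho_inj R_domain) => [/eqP|->]; rewrite ?eqxx ?(negPf x0).
(* With the roles exchanged the bound falls on y; comparing the sizes of the two sides of x h = y f
   carries it over to x. *)
have leh : (size h <= size y)%N.
  apply: (step h f y x) => //; [by rewrite addnC | exact: ltnW |].
  by move=> d e e' Eh Ef; apply: cop Ef Eh.
have := congr1 (size \o @polyseq R) E; rewrite /= !size_twp // => /(congr1 S).
rewrite !prednK ?addn_gt0 ?size_poly_gt0 ?x0 ?y0 // => Es.
by rewrite -(leq_add2r (size h)) Es addnC leq_add2r.
Qed.
End RightDivision.

(** * The quotient by t^n - c *)

Lemma ext_ord (R : zmodType) n (g : {ffun 'I_n -> R}) (i : 'I_n) : ext g i = g i.
Proof. by rewrite /ext valK. Qed.

Lemma ext_ge (R : zmodType) n (g : {ffun 'I_n -> R}) i : (n <= i)%N -> ext g i = 0.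
Proof. by move=> le; rewrite /ext insubN // -leqNgt. Qed.

Lemma cembB (R : zmodType) n : {morph @cemb R n : x y / x - y}.
Proof. by move=> x y; apply/ffunP => i; rewrite !ffunE; case: eqP; rewrite ?subrr. Qed.

Lemma cembD (R : zmodType) n : {morph @cemb R n : x y / x + y}.
Proof. by move=> x y; apply/ffunP => i; rewrite !ffunE; case: eqP; rewrite ?addr0. Qed.

Lemma cemb_inj (R : zmodType) n : (0 < n)%N -> injective (@cemb R n).
Proof.
by move=> n0 x y /(congr1 (fun g : {ffun 'I_n -> R} => g (Ordinal n0))); rewrite !ffunE.
Qed.

Lemma morphD_zmod_morphism (U V : zmodType) (f : U -> V) :
  {morph f : x y / x + y} -> zmod_morphism f.
Proof. by move=> fD x y; apply: (addIr (f y)); rewrite -fD !subrK. Qed.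

Lemma inj_surj_bij (T : choiceType) (f : T -> T) :
  injective f -> (forall v, exists u, v = f u) -> bijective f.
Proof.
move=> f_inj f_surj.
have H v : exists u, v == f u by case: (f_surj v) => u ->; exists u.
have K : cancel (fun v => xchoose (H v)) f by move=> v; rewrite -(eqP (xchooseP (H v))).
by exists (fun v => xchoose (H v)) => // u; apply: f_inj; rewrite K.
Qed.

Lemma bij_surj (A B : Type) (f : A -> B) v : bijective f -> exists u, f u = v.
Proof. by case=> g _ gK; exists (g v). Qed.

Section QuotientAlgebra.
Variables (R : nzRingType) (rho : {rmorphism R -> R}) (n : nat) (c : R).
Local Notation T := {ffun 'I_n -> R}.
Local Notation "g ** h" := (qmul *%R rho n c g h) (at level 40).
Local Notation f := ('X^n - c%:P).

Definition poly_of (g : T) : {poly R} := \poly_(i < n) ext g i.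

Lemma coef_poly_of g l : (poly_of g)`_l = ext g l.
Proof. by rewrite coef_poly; case: ltnP => // /ext_ge ->. Qed.

Lemma size_poly_of g : (size (poly_of g) <= n)%N.
Proof. exact: size_poly. Qed.

Lemma ffun_sub (g h : T) i : (g - h) i = g i - h i.
Proof. by rewrite !ffunE. Qed.

Lemma poly_of_inj : injective poly_of.
Proof. by move=> g h E; apply/ffunP => i; rewrite -!ext_ord -!coef_poly_of E. Qed.

Lemma poly_of0 : poly_of 0 = 0.
Proof.
apply/polyP => l; rewrite coef_poly_of coef0.
have [lt|/ext_ge -> //] := ltnP l n.
by rewrite -[l]/(val (Ordinal lt)) ext_ord ffunE.
Qed.

Lemma poly_of_eq0 g : (poly_of g == 0) = (g == 0).
Proof. by rewrite -poly_of0 (inj_eq poly_of_inj). Qed.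

Lemma poly_ofB g h : poly_of (g - h) = poly_of g - poly_of h.
Proof.
apply/polyP => l; rewrite coefB !coef_poly_of.
have [lt|le] := ltnP l n; last by rewrite !ext_ge // subrr.
by rewrite -[l]/(val (Ordinal lt)) !ext_ord !ffunE.
Qed.

Lemma qmulE g h (l : 'I_n) : (g ** h) l =
  (twp rho (poly_of g) (poly_of h))`_l +
  (twp rho (poly_of g) (poly_of h))`_(l + n) * iter l rho c.
Proof.
rewrite ffunE !coef_twp; congr (_ + _ * _).
  by apply: eq_bigr => i _; rewrite !coef_poly_of.
by apply: eq_bigr => i _; rewrite !coef_poly_of.
Qed.

Lemma coef_twp_binom (p : {poly R}) l : (twp rho p f)`_l =
  (if (l < n)%N then 0 else p`_(l - n)) - p`_l * iter l rho c.
Proof. by rewrite twpBr twpX coefB coefMXn coef_twpC. Qed.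

(** The quotient is the upper half of the product: all coefficients from degree 2n on vanish, so
    those of degree l + n with l < n suffice. *)
Lemma poly_of_qmul g h : exists s,
  twp rho (poly_of g) (poly_of h) = poly_of (g ** h) + twp rho s f.
Proof.
set p := twp rho _ _; exists (\poly_(l < n) p`_(l + n)); apply/polyP => l.
rewrite coefD coef_poly_of coef_twp_binom !coef_poly.
have [lt|le] := ltnP l n.
  by rewrite -[l]/(val (Ordinal lt)) ext_ord qmulE sub0r addrK.
rewrite ext_ge // mul0r subr0 add0r subnK //; case: ltnP => // le2.
rewrite coef_twp /tw_mulp big1 // => i _; rewrite !coef_poly_of.
have [lti|lei] := ltnP i n; last by rewrite ext_ge ?mul0r.
rewrite [ext h _]ext_ge ?iter_rmorph0 ?mulr0 //.
by apply: leq_trans le2 (leq_sub2l _ (ltnW lti)).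
Qed.

Lemma qmulBl g g' h : (g - g') ** h = g ** h - g' ** h.
Proof.
apply/ffunP => l; rewrite ffun_sub !qmulE poly_ofB twpBl !coefB mulrBl.
by rewrite opprD addrACA.
Qed.

Lemma qmulBr g h h' : g ** (h - h') = g ** h - g ** h'.
Proof.
apply/ffunP => l; rewrite ffun_sub !qmulE poly_ofB twpBr !coefB mulrBl.
by rewrite opprD addrACA.
Qed.

Lemma qmulx0 g : g ** 0 = 0.
Proof. by rewrite -[in LHS](subrr 0) qmulBr subrr. Qed.

Lemma qmul0x g : 0 ** g = 0.
Proof. by rewrite -[in LHS](subrr 0) qmulBl subrr. Qed.

Lemma qmulDr g h h' : g ** (h + h') = g ** h + g ** h'.
Proof. by rewrite -[h']opprK qmulBr -[in RHS]sub0r qmulBr qmulx0 sub0r. Qed.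

Lemma qmulDl g g' h : (g + g') ** h = g ** h + g' ** h.
Proof. by rewrite -[g']opprK qmulBl -[in RHS]sub0r qmulBl qmul0x sub0r. Qed.

Lemma poly_of_cemb x : (0 < n)%N -> poly_of (cemb n x) = x%:P.
Proof.
move=> n0; apply/polyP => l; rewrite coef_poly_of coefC.
have [lt|le] := ltnP l n.
  by rewrite -[l]/(val (Ordinal lt)) ext_ord ffunE.
by rewrite ext_ge //; case: eqP le => // ->; rewrite leqNgt n0.
Qed.

Lemma qmul_cembl x h : (0 < n)%N -> cemb n x ** h = [ffun i => x * h i].
Proof.
move=> n0; apply/ffunP => l; rewrite qmulE poly_of_cemb //.
have E : twp rho x%:P (poly_of h) = x *: poly_of h.
  by rewrite -[x%:P]mulr1 mul_polyC twpZl tw1p.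
rewrite E !coefZ !coef_poly_of ext_ord [ext h (_ + _)]ext_ge ?leq_addl //.
by rewrite mulr0 mul0r addr0 ffunE.
Qed.

Lemma qmul_cembl_ord x h i : (0 < n)%N -> (cemb n x ** h) i = x * h i.
Proof. by move=> n0; rewrite qmul_cembl // ffunE. Qed.

Lemma qmul_cembr x h : (0 < n)%N -> h ** cemb n x = [ffun i : 'I_n => h i * iter i rho x].
Proof.
move=> n0; apply/ffunP => l; rewrite qmulE poly_of_cemb // !coef_twpC !coef_poly_of.
by rewrite ext_ord [ext h (_ + _)]ext_ge ?leq_addl // !mul0r addr0 ffunE.
Qed.

(** Constants on the far left act coefficientwise, so they associate even where the quotient is not
    associative; this makes right multiplications linear over the coefficients. *)
Lemma qmul_scalel x g h : (0 < n)%N -> (cemb n x ** g) ** h = cemb n x ** (g ** h).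
Proof.
move=> n0; apply/ffunP => l; rewrite [RHS]qmul_cembl_ord // !qmulE.
have -> : poly_of (cemb n x ** g) = x *: poly_of g.
  apply/polyP => i; rewrite coefZ !coef_poly_of qmul_cembl //.
  have [lt|le] := ltnP i n; last by rewrite !ext_ge // mulr0.
  by rewrite -[i]/(val (Ordinal lt)) !ext_ord ffunE.
by rewrite twpZl !coefZ mulrDr mulrA.
Qed.

Lemma qmul_cemb x y : (0 < n)%N -> cemb n x ** cemb n y = cemb n (x * y).
Proof.
move=> n0; rewrite qmul_cembl //; apply/ffunP => i; rewrite !ffunE.
by case: eqP; rewrite ?mulr0.
Qed.

Lemma qmul_fixed_centerC z g : (0 < n)%N -> (forall x, z * x = x * z) -> rho z = z ->
  cemb n z ** g = g ** cemb n z.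
Proof.
move=> n0 zC rz; rewrite qmul_cembl // qmul_cembr //; apply/ffunP => i; rewrite !ffunE.
by rewrite zC; congr (_ * _); elim: (nat_of_ord i) => //= j <-.
Qed.

Lemma qmul_scaler z g h : (0 < n)%N -> (forall x, z * x = x * z) -> rho z = z ->
  g ** (cemb n z ** h) = cemb n z ** (g ** h).
Proof.
move=> n0 zC rz; apply/ffunP => l.
rewrite [RHS]qmul_cembl_ord // !qmulE.
have -> : poly_of (cemb n z ** h) = z *: poly_of h.
  apply/polyP => i; rewrite coefZ !coef_poly_of qmul_cembl //.
  have [lt|le] := ltnP i n; last by rewrite !ext_ge // mulr0.
  by rewrite -[i]/(val (Ordinal lt)) !ext_ord ffunE.
have -> p q : twp rho p (z *: q) = z *: twp rho p q.
  rewrite /twp scaler_sumr; apply: eq_bigr => i _.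
  rewrite scalerA zC -scalerA; congr (_ *: _).
  by elim: (nat_of_ord i) => //= j ->; rewrite shiftpZ rz.
by rewrite !coefZ mulrDr mulrA.
Qed.

(** Such a constant commutes with everything and can be pulled out of either factor. It turns finite
    dimension over the fixed central constants into finite dimension over the right nucleus. *)
Lemma fixed_center_right_nucleus z : (0 < n)%N ->
  (forall x, z * x = x * z) -> rho z = z ->
  right_nucleus (qmul *%R rho n c) (cemb n z).
Proof.
move=> n0 zC rz x y.
by rewrite -!(qmul_fixed_centerC _ n0 zC rz) qmul_scaler.
Qed.

(** Uniqueness of the remainder: the modulus is monic, so the leading coefficient of a nonzero s
    reappears n degrees higher, over any ring R. *)
Lemma twp_binom_size (s : {poly R}) : (0 < n)%N ->
  (size (twp rho s f) <= n)%N -> s = 0.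
Proof.
move=> n0 sz; apply/eqP/negPn/negP => s0.
have [k Ek] : exists k, size s = k.+1.
  by exists (size s).-1; rewrite prednK // size_poly_gt0.
have: (twp rho s f)`_(k + n) = 0 by rewrite nth_default // (leq_trans sz) ?leq_addl.
rewrite coef_twp_binom ltnNge leq_addl /= addnK.
rewrite [s`_(k + n)]nth_default ?mul0r ?subr0; last by rewrite Ek -addn1 leq_add2l.
by move/eqP; rewrite -[k]/(k.+1.-1) -Ek -lead_coefE lead_coef_eq0 (negPf s0).
Qed.

(* The hypotheses make [t^n - c] central in [R[t;rho]], hence a two-sided
   modulus. *)
Lemma qmulA_central : (0 < n)%N -> (forall x, c * x = x * c) -> rho c = c ->
  (forall x, iter n rho x = x) -> associative (qmul *%R rho n c).
Proof.
move=> n0 cC rc rn x y z.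
have fC p : twp rho f p = twp rho p f.
  rewrite twpBl twpBr; congr (_ - _).
    rewrite twpX /twp size_polyXn big_ord_recr /= coefXn eqxx scale1r.
    rewrite big1 ?add0r => [|i _]; last by rewrite coefXn ltn_eqF // scale0r.
    by apply/polyP => l; rewrite coef_iter_shiftp coefMXn; case: ifP.
  apply/polyP => l; rewrite coef_twpC -[c%:P]mulr1 mul_polyC twpZl tw1p coefZ cC.
  by congr (_ * _); elim: l => //= l <-.
have [s1 E1] := poly_of_qmul x y; have [s2 E2] := poly_of_qmul (x ** y) z.
have [s3 E3] := poly_of_qmul y z; have [s4 E4] := poly_of_qmul x (y ** z).
(* u and v are the quotients for the two bracketings of the triple product. The two remainders
   differ by (u - v) f, which is too short to be nonzero. *)
pose u := twp rho s1 (poly_of z) + s2; pose v := twp rho (poly_of x) s3 + s4.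
have F1 : poly_of ((x ** y) ** z) =
    twp rho (twp rho (poly_of x) (poly_of y)) (poly_of z) - twp rho u f.
  have E' : twp rho (twp rho s1 f) (poly_of z) = twp rho (twp rho s1 (poly_of z)) f.
    by rewrite !twpA fC.
  by rewrite /u E1 !twpDl E2 E' -[X in X - _]addrA [X in _ + X - _]addrC addrK.
have F2 : poly_of (x ** (y ** z)) =
    twp rho (twp rho (poly_of x) (poly_of y)) (poly_of z) - twp rho v f.
  by rewrite /v twpA E3 twpDr E4 -twpA twpDl -[X in X - _]addrA [X in _ + X - _]addrC addrK.
have E : poly_of (x ** (y ** z)) - poly_of ((x ** y) ** z) = twp rho (u - v) f.
  by rewrite F1 F2 twpBl opprB addrC addrA subrK.
apply: poly_of_inj; apply/eqP; rewrite -subr_eq0 E.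
rewrite (_ : u - v = 0) ?tw0p //; apply: twp_binom_size => //.
by rewrite -E -poly_ofB size_poly_of.
Qed.

(** * Extending an endomorphism of R to the quotient *)

Variables (tau : {rmorphism R -> R}) (N : nat -> R).
Hypothesis tau_rho : forall x, tau (rho x) = rho (tau x).
Hypothesis N_central : forall i x, N i * x = x * N i.
Hypothesis ND : forall i j, N (i + j)%N = N i * iter i rho (N j).
Hypothesis tau_c : tau c = N n * c.

Let tau_iter i x : tau (iter i rho x) = iter i rho (tau x).
Proof. by elim: i => //= i <-. Qed.

(** The common form of the map tau on A (identity on D, N_i = omega^i) and of the required
    automorphism of B. *)
Definition twist (g : T) : T := [ffun i : 'I_n => tau (g i) * N i].

Lemma twistD : {morph twist : g h / g + h}.
Proof. by move=> g h; apply/ffunP => i; rewrite !ffunE rmorphD mulrDl. Qed.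

(** The cocycle identity [ND] and centrality make t^i |-> N_i t^i multiplicative before reduction,
    and [tau_c] sends t^n - c to N_n (t^n - c), so remainders are respected. *)
Lemma twistM : {morph twist : g h / g ** h}.
Proof.
move=> g h.
have ext_twist k l : ext (twist k) l = tau (ext k l) * N l.
  have [lt|le] := ltnP l n; last by rewrite !ext_ge // rmorph0 mul0r.
  by rewrite -[l]/(val (Ordinal lt)) !ext_ord ffunE.
have coefE l : (twp rho (poly_of (twist g)) (poly_of (twist h)))`_l =
    tau (twp rho (poly_of g) (poly_of h))`_l * N l.
  rewrite !coef_twp /tw_mulp rmorph_sum mulr_suml; apply: eq_bigr => i _.
  rewrite !coef_poly_of !ext_twist iter_rmorphM rmorphM tau_iter.
  have lei : (i <= l)%N by rewrite -ltnS.
  have -> : N l = N i * iter i rho (N (l - i)%N) by rewrite -ND subnKC.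
  by rewrite -!mulrA; congr (_ * _); rewrite !mulrA N_central.
apply/ffunP => l; rewrite ffunE !qmulE !coefE rmorphD mulrDl; congr (_ + _).
rewrite rmorphM tau_iter tau_c iter_rmorphM -!mulrA; congr (_ * _).
by rewrite mulrA -N_central ND !mulrA.
Qed.

Lemma iter_twist j g : (forall i, tau (N i) = N i) ->
  iter j twist g = [ffun i : 'I_n => iter j tau (g i) * N i ^+ j].
Proof.
move=> tauN; apply/ffunP => i; rewrite ffunE.
elim: j => [|j IH] /=; first by rewrite expr0 mulr1.
by rewrite ffunE IH rmorphM rmorphXn tauN -mulrA -exprSr.
Qed.
End QuotientAlgebra.

(** * Division *)

Section LeftMultiplication.
Variables (T : zmodType) (mul : T -> T -> T) (one : T).
Hypothesis mulBl : forall x y z, mul (x - y) z = mul x z - mul y z.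
Hypothesis mulBr : forall x y z, mul x (y - z) = mul x y - mul x z.
Hypothesis mul1 : forall x, mul one x = x.
Hypothesis mulr1 : forall x, mul x one = x.
Hypothesis mul_eq0 : forall x y, mul x y = 0 -> x = 0 \/ y = 0.
Hypothesis rmul_surj : forall c, c != 0 -> forall v, exists u, v = mul u c.

Let rmul_inj c x y : c != 0 -> mul x c = mul y c -> x = y.
Proof.
move=> c0 E; apply/eqP; rewrite -subr_eq0.
have /mul_eq0[->//|cE]: mul (x - y) c = 0 by rewrite mulBl E subrr.
by rewrite cE eqxx in c0.
Qed.

(** Surjectivity of right multiplication gives a left inverse, and cancelling e on the right puts it
    in the nucleus. A left inverse of that inverse must then equal c, so the inverse is
    two-sided. *)
Let right_nucleus_inv c : right_nucleus mul c -> c != 0 ->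
  exists2 d, right_nucleus mul d & mul c d = one.
Proof.
have linv e : right_nucleus mul e -> e != 0 ->
    exists2 d, right_nucleus mul d & mul d e = one.
  move=> Ne e0; have [d /esym dE] := rmul_surj e0 one.
  exists d => // y z; apply: (rmul_inj e0).
  by rewrite Ne dE mulr1 (Ne y (mul z d)) (Ne z d) dE mulr1.
have mul0 x : mul x 0 = 0 by rewrite -[in LHS](subrr 0) mulBr subrr.
have mul0' x : mul 0 x = 0 by rewrite -[in LHS](subrr 0) mulBl subrr.
move=> Nc c0; have [d Nd dc] := linv c Nc c0; exists d => //.
have d0 : d != 0.
  apply: contraNneq c0 => d0; move: dc; rewrite d0 mul0' => one0.
  by rewrite -[c]mul1 -one0 mul0'.
have [e Ne ed] := linv d Nd d0.
by rewrite -[c]mul1 -ed (Nc e d) dc mulr1.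
Qed.

(* Left multiplications are linear over the right nucleus, which is a
   division ring. *)
Lemma left_mul_surjective x : fin_dim_right_nucleus mul -> x != 0 ->
  forall v, exists u, v = mul x u.
Proof.
case=> m [e gen] x0.
have mul0 y : mul y 0 = 0 by rewrite -[in LHS](subrr 0) mulBr subrr.
pose S (s : T -> T) := exists2 c, right_nucleus mul c & forall v, s v = mul v c.
have phi_eq0 v : mul x v = 0 -> v = 0.
  by case/mul_eq0 => // xE; rewrite xE eqxx in x0.
have S_id : exists2 s, S s & forall v, s v = v.
  by exists id => //; exists one => // y z; rewrite !mulr1.
have S_sub s s' : S s -> S s' -> exists2 s'', S s'' & forall v, s'' v = s v - s' v.
  case=> c Nc sE [c' Nc' sE']; exists (fun v => mul v (c - c')).
    by exists (c - c') => // y z; rewrite !mulBr Nc Nc'.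
  by move=> v; rewrite sE sE' mulBr.
apply: (@injective_surjective T S S_id _ S_sub _ _ (mul x) _ _ _
  [seq e i | i <- index_enum 'I_m]) => //.
- by move=> s u v [c _ sE]; rewrite !sE mulBl.
- move=> s s' [c Nc sE] [c' Nc' sE']; exists (fun v => mul v (mul c' c)).
    exists (mul c' c) => // y z.
    by rewrite -(Nc (mul y z) c') Nc' (Nc y) (Nc z).
  by move=> v; rewrite sE sE' Nc.
- move=> s v [c Nc sE] sv0.
  have c0 : c != 0 by apply: contraNneq sv0 => c0; rewrite sE c0 mul0.
  have [d Nd cd] := right_nucleus_inv Nc c0.
  exists (fun v => mul v d); first by exists d.
  by move=> u; rewrite sE Nd cd mulr1.
- by move=> s v [c Nc sE]; rewrite !sE Nc.
move=> v; have [c [Nc ->]] := gen v.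
by apply: (@span_sum T S S_id S_sub _ _ _ (fun i v => mul v (c i))) => i; exists (c i).
Qed.

End LeftMultiplication.

(** * Division in the quotient by an irreducible binomial *)

Section PetitDivision.
Variables (R : nzRingType) (rho : {rmorphism R -> R}) (n : nat) (c : R).
Hypothesis rho_inj : injective rho.
Hypothesis R_inv : forall x : R, x != 0 -> exists y, y * x = 1.
Hypothesis n_gt0 : (0 < n)%N.
Hypothesis irr : tw_irreducible *%R rho 1 (tw_binom 1 n c).
Local Notation T := {ffun 'I_n -> R}.
Local Notation "g ** h" := (qmul *%R rho n c g h) (at level 40).
Local Notation f := ('X^n - c%:P).

Let R_domain := division_ring_domain R_inv.

Lemma size_tw_unit (p : {poly R}) : tw_unit *%R rho 1 (nth 0 p) -> (size p <= 1)%N.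
Proof.
case=> u [[N uN] [pu _]].
pose U := \poly_(i < N) u i.
have UE l : U`_l = u l by rewrite coef_poly; case: ltnP => // /uN ->.
have E : twp rho p U = 1.
  apply/polyP => l; rewrite coef_twp coef1.
  transitivity (tw_one (1 : R) l); last by rewrite /tw_one; case: eqP.
  by rewrite -pu; apply: eq_bigr => i _; rewrite UE.
have p0 : p != 0 by apply: contra_eq_neq E => ->; rewrite tw0p eq_sym oner_neq0.
have U0 : U != 0 by apply: contra_eq_neq E => ->; rewrite twp0 eq_sym oner_neq0.
have: size (twp rho p U) = 1%N by rewrite E size_poly1.
rewrite size_twp //.
by move: p0 U0; rewrite -!size_poly_gt0; lia.
Qed.

Lemma size_binom : size f = n.+1.
Proof. by rewrite size_XnsubC. Qed.

Lemma binom_right_factor d e : f = twp rho e d -> (size d <= 1)%N \/ size d = n.+1.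
Proof.
move=> E; have f0 : f != 0 by rewrite -size_poly_gt0 size_binom.
have tw p : tw_poly (nth 0 (p : {poly R})).
  by exists (size p) => l; apply: nth_default.
have [_ _ /(_ (nth 0 e) (nth 0 d) (tw e) (tw d))] := irr.
case=> [l|/size_tw_unit se|/size_tw_unit]; [|right|by left].
  rewrite -coef_twp -E coefB coefXn coefC /tw_binom.
  by case: eqP.
have e0 : e != 0 by apply: contraNneq f0 => e0; rewrite E e0 tw0p.
have d0 : d != 0 by apply: contraNneq f0 => d0; rewrite E d0 twp0.
have: size (twp rho e d) = n.+1 by rewrite -E size_binom.
rewrite size_twp //.
by move: se e0 d0; rewrite -!size_poly_gt0; lia.
Qed.

Lemma qmul_eq0 g h : g ** h = 0 -> g = 0 \/ h = 0.
Proof.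
have [->|g0] := eqVneq g 0; first by left.
have [->|h0 gh] := eqVneq h 0; [by right | exfalso].
have [s E] := poly_of_qmul rho c g h; rewrite gh poly_of0 add0r in E.
rewrite -poly_of_eq0 in g0; rewrite -poly_of_eq0 in h0.
suff cop d e e' : f = twp rho e d -> poly_of h = twp rho e' d -> (size d <= 1)%N.
  have f0 : f != 0 by rewrite -size_poly_gt0 size_binom.
  have := coprime_size_cofactor rho_inj R_inv cop f0 g0 E.
  by rewrite size_binom ltnNge size_poly_of.
(* A right divisor of f of size n + 1 is too long to divide h. *)
move=> /binom_right_factor[//|szd] Eh.
have d0 : d != 0 by rewrite -size_poly_gt0 szd.
have e'0 : e' != 0 by apply: contraNneq h0 => e'0; rewrite Eh e'0 tw0p.
have := size_poly_of h; rewrite Eh (size_twp rho_inj R_domain) // szd.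
by move: e'0; rewrite -size_poly_gt0; lia.
Qed.

(** The scalars are left multiplications by constants and the generators are the powers of t;
    injectivity of right multiplication is absence of zero divisors. *)
Lemma qmul_right_surjective h : h != 0 -> forall v, exists u, v = u ** h.
Proof.
move=> h0.
pose S (s : T -> T) := exists x, forall v, s v = cemb n x ** v.
have S_id : exists2 s, S s & forall v, s v = v.
  exists id => //; exists 1 => v; rewrite qmul_cembl //.
  by apply/ffunP => i; rewrite ffunE mul1r.
have S_sub s s' : S s -> S s' -> exists2 s'', S s'' & forall v, s'' v = s v - s' v.
  case=> x sE [y s'E]; exists (fun v => cemb n (x - y) ** v); first by exists (x - y).
  by move=> v; rewrite cembB qmulBl sE s'E.
apply: (@injective_surjective T S S_id _ S_sub _ _ ((qmul *%R rho n c)^~ h) _ _ _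
  [seq [ffun j => (i == j)%:R] | i : 'I_n <- index_enum 'I_n]) => //.
- by move=> s u v [x sE]; rewrite !sE qmulBr.
- move=> s s' [x sE] [y s'E]; exists (fun v => cemb n (x * y) ** v); first by exists (x * y).
  by move=> v; rewrite sE s'E -qmul_scalel // qmul_cemb.
- move=> s v [x sE] sv0.
  have /R_inv[y yx] : x != 0.
    apply: contraNneq sv0 => x0; rewrite sE x0 qmul_cembl //.
    by apply/eqP/ffunP => i; rewrite !ffunE mul0r.
  exists (fun v => cemb n y ** v); first by exists y.
  move=> u; rewrite sE -qmul_scalel // qmul_cemb // yx qmul_cembl //.
  by apply/ffunP => i; rewrite ffunE mul1r.
- by move=> u v; rewrite qmulBl.
- by move=> s v [x sE]; rewrite !sE qmul_scalel.
- by move=> v /qmul_eq0[//|h0']; rewrite h0' eqxx in h0.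
move=> v.
have -> : v = \sum_i (cemb n (v i) ** [ffun j => (i == j)%:R]).
  apply/ffunP => j; rewrite sum_ffunE (bigD1 j) //= big1 => [|i ij].
    by rewrite addr0 qmul_cembl_ord // ffunE eqxx mulr1.
  by rewrite qmul_cembl_ord // ffunE (negPf ij) mulr0.
by apply: (@span_sum T S S_id S_sub _ _ _ (fun i v' => cemb n (v i) ** v')) => i; exists (v i).
Qed.

Lemma petit_division_alg :
  fin_dim_right_nucleus (qmul *%R rho n c) -> division_alg (qmul *%R rho n c).
Proof.
move=> fd x x0; split; apply: inj_surj_bij.
- move=> u v E; apply/eqP; rewrite -subr_eq0.
  have /qmul_eq0[xE|->//] : x ** (u - v) = 0 by rewrite qmulBr E subrr.
  by rewrite xE eqxx in x0.
- apply: (left_mul_surjective (one := cemb n 1)) => //.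
  + exact: qmulBl.
  + exact: qmulBr.
  + by move=> y; rewrite qmul_cembl //; apply/ffunP => i; rewrite ffunE mul1r.
  + move=> y; rewrite qmul_cembr //; apply/ffunP => i.
    by rewrite ffunE iter_rmorph1 mulr1.
  + exact: qmul_eq0.
  + exact: qmul_right_surjective.
- move=> u v E; apply/eqP; rewrite -subr_eq0.
  have /qmul_eq0[->//|xE] : (u - v) ** x = 0 by rewrite qmulBl E subrr.
  by rewrite xE eqxx in x0.
- exact: qmul_right_surjective.
Qed.
End PetitDivision.

(** * Generalized cyclic algebras *)

(** Associativity of A is only derived in the course of the proof, so its ring structure has to be
    built from a proof term. [ring_of] keeps carrier and product, so results on rings apply to
    [cycA] and [cycB] by conversion. *)
Record unital_ring_axioms (T : zmodType) (mul : T -> T -> T) (one : T) : Prop :=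
  UnitalRingAxioms {
    ura_mulA : associative mul;
    ura_mul1 : left_id one mul;
    ura_mulr1 : right_id one mul;
    ura_mulDl : left_distributive mul +%R;
    ura_mulDr : right_distributive mul +%R;
    ura_one_neq0 : one != 0 }.

Definition ring_of (T : zmodType) mul one (_ : @unital_ring_axioms T mul one) : Type := T.

HB.instance Definition _ T mul one (ax : @unital_ring_axioms T mul one) :=
  GRing.Zmodule.copy (ring_of ax) T.

HB.instance Definition _ T mul one (ax : @unital_ring_axioms T mul one) :=
  GRing.Zmodule_isNzRing.Build (ring_of ax) (ura_mulA ax) (ura_mul1 ax) (ura_mulr1 ax)
    (ura_mulDl ax) (ura_mulDr ax) (ura_one_neq0 ax).

Definition rmorphism_of (R : nzRingType) (f : R -> R)
    (fB : zmod_morphism f) (f1M : monoid_morphism f) : {rmorphism R -> R} :=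
  HB.pack f (GRing.isZmodMorphism.Build R R f fB)
    (GRing.isMonoidMorphism.Build R R f f1M).

(** * Invertible constants when the coefficients are not yet known to associate *)

Section NonassociativeCoefficients.
Variables (T : zmodType) (mul : T -> T -> T) (one : T) (rho : T -> T).
Hypothesis mul0x : forall x, mul 0 x = 0.
Hypothesis mulx0 : forall x, mul x 0 = 0.
Hypothesis divA : division_alg mul.
Hypothesis one_neq0 : one != 0.
Hypothesis rho_inj : injective rho.
Hypothesis rho0 : rho 0 = 0.

Let mul_neq0 x y : x != 0 -> y != 0 -> mul x y != 0.
Proof.
move=> x0; apply: contra_neq => xy.
by apply: (bij_inj (divA x0).1); rewrite xy mulx0.
Qed.

Let iter_rho0 i : iter i rho 0 = 0.
Proof. by elim: i => //= i ->. Qed.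

Let iter_rho_neq0 i x : x != 0 -> iter i rho x != 0.
Proof.
by move=> x0; elim: i => //= i; apply: contra_neq => E; apply: rho_inj; rewrite E.
Qed.

(** The leading coefficient h_n rho^n(u_M) of the product is nonzero in degree n + M > 0, which
    needs no associativity. *)
Lemma tw_unit_degree n h : tw_unit mul rho one h -> (0 < n)%N -> h n != 0 ->
  (forall l, (n < l)%N -> h l = 0) -> False.
Proof.
case=> u [[N uN] [hu _]] n0 hn0 h0.
have [M uM0 uM] : exists2 M, u M != 0 & forall l, (M < l)%N -> u l = 0.
  elim: N uN => [|N IH] uN.
    move: one_neq0; rewrite -[one]/(tw_one one 0) -hu /tw_mulp big_ord1 uN //.
    by rewrite mulx0 eqxx.
  have [uN0|uN0] := eqVneq (u N) 0; last by exists N.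
  by apply: IH => l; rewrite leq_eqVlt => /orP[/eqP <-|/uN].
have := hu (n + M)%N; rewrite /tw_one addn_eq0 -[n == 0]leqn0 leqNgt n0 /=.
have ltn : (n < (n + M).+1)%N by rewrite ltnS leq_addr.
rewrite /tw_mulp (bigD1 (Ordinal ltn)) //= addKn big1 ?addr0 => [|i].
  by apply/eqP/mul_neq0 => //; apply: iter_rho_neq0.
rewrite -val_eqE /= neq_ltn => /orP[lti|/h0 ->]; last by rewrite mul0x.
by rewrite uM ?iter_rho0 ?mulx0 //; lia.
Qed.

(* A constant [x] is always a left factor of [t^n - c], so irreducibility
   makes it a unit. *)
Lemma irreducible_two_sided_inverse n c x :
  (0 < n)%N -> tw_irreducible mul rho one (tw_binom one n c) -> x != 0 ->
  exists u, mul x u = one /\ mul u x = one.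
Proof.
move=> n0 [_ _ irr] x0; have [[g gK Kg] _] := divA x0.
(* Solving x h_l = f_l in each degree factors f as x h, and h, of positive degree n, is no unit. *)
pose h l := g (tw_binom one n c l).
pose px := tw_one x.
have bin0 l : (n < l)%N -> tw_binom one n c l = 0.
  by move=> lt; rewrite /tw_binom !gtn_eqF ?subrr //; lia.
have h0 l : (n < l)%N -> h l = 0.
  by move=> lt; rewrite /h bin0 // -[in LHS](mulx0 x) gK.
have hn0 : h n != 0.
  apply: contra_neq one_neq0 => hn; have := Kg (tw_binom one n c n).
  by rewrite -/(h n) hn mulx0 /tw_binom eqxx gtn_eqF // subr0.
case: (irr px h) => [|||[u [_ [xu ux]]]|/tw_unit_degree].
- by exists 1%N => l; rewrite /px /tw_one; case: l.
- by exists n.+1.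
- move=> l; rewrite /tw_mulp big_ord_recl big1 => [|i _]; last by rewrite mul0x.
  by rewrite addr0 subn0 /px /tw_one /= /h Kg.
- have := xu 0; have := ux 0; rewrite /tw_mulp !big_ord1 /= => E1 E2.
  by exists (u 0); split.
by move/(_ n n0 hn0 h0).
Qed.
End NonassociativeCoefficients.

Section GeneralizedCyclicAlgebra.
Variables (D : unitRingType) (sigma : {rmorphism D -> D}) (q : nat) (a : D).
Hypothesis D_unit : forall x : D, x != 0 -> x \is a GRing.unit.
Hypothesis sigma_bij : bijective sigma.
Hypothesis q_gt0 : (0 < q)%N.
Hypothesis aF0 : inF0 sigma a.
Hypothesis divA : division_alg (cycA sigma q a).
Local Notation T := {ffun 'I_q -> D}.

Definition monom i (x : D) : T := [ffun j : 'I_q => if val j == i then x else 0].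

Lemma qmul_monom i j x y : (i < q)%N -> (j < q)%N -> i + j = q ->
  cycA sigma q a (monom i x) (monom j y) = cemb q (x * iter i sigma y * a).
Proof.
move=> lti ltj ijq.
have poly_monom k z : (k < q)%N -> poly_of (monom k z) = z *: 'X^k.
  move=> ltk; apply/polyP => l; rewrite coef_poly_of coefZ coefXn.
  have [lt|le] := ltnP l q.
    by rewrite -[l]/(val (Ordinal lt)) ext_ord ffunE; case: eqP; rewrite ?mulr1 ?mulr0.
  by rewrite ext_ge // gtn_eqF ?mulr0 //; apply: leq_trans le.
have E : twp sigma (x *: 'X^i) (y *: 'X^j) = (x * iter i sigma y) *: 'X^q.
  apply/polyP => l; rewrite twpZl /twp size_polyXn big_ord_recr /= coefXn eqxx scale1r.
  rewrite big1 ?add0r => [|k _]; last by rewrite coefXn ltn_eqF // scale0r.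
  rewrite !coefZ coef_iter_shiftp coefZ !coefXn.
  have [lt|le] := ltnP l i; first by rewrite mulr0 ltn_eqF ?mulr0 //; lia.
  have -> : (l - i == j)%N = (l == q) by lia.
  by case: eqP; rewrite ?mulr1 // ?mulr0 iter_rmorph0 mulr0.
apply/ffunP => l; rewrite [LHS]qmulE !poly_monom // E !coefZ !coefXn.
rewrite ltn_eqF // mulr0 add0r ffunE -[X in _ == X]add0n eqn_add2r.
by case: eqP => [->|]; rewrite ?mulr1 ?mulr0 ?mul0r.
Qed.

(** The inverse of d t is some e t^(q-1). The two orders of multiplication give d sigma(e) a = 1
    and, after applying sigma, sigma(e) sigma^q(d) a = 1; as a is central, d a and sigma^q(d) a are
    both inverse to sigma(e). *)
Lemma two_sided_inverse_sigma_order : (1 < q)%N ->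
  (forall x : T, x != 0 -> exists u, cycA sigma q a x u = cemb q 1 /\
    cycA sigma q a u x = cemb q 1) ->
  forall d, iter q sigma d = d.
Proof.
move=> q1 inv d; have [aC sa] := aF0.
have [->|d0] := eqVneq d 0; first exact: iter_rmorph0.
have monom_neq0 i x : (i < q)%N -> x != 0 -> monom i x != 0.
  move=> lti; apply: contra_neq => /(congr1 (fun g : T => g (Ordinal lti))).
  by rewrite !ffunE eqxx.
have ltq1 : (q.-1 < q)%N by rewrite prednK.
have E1q : (1 + q.-1 = q)%N by rewrite add1n prednK.
have Eq1 : (q.-1 + 1 = q)%N by rewrite addn1 prednK.
have cembD0 (x : D) : cemb q x = 0 -> x = 0.
  by move/(congr1 (fun g : T => g (Ordinal q_gt0))); rewrite !ffunE.
(* If a = 0, the nonzero elements t and t^(q-1) of A have product 0. *)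
have a0 : a != 0.
  apply: contraTneq (monom_neq0 _ 1 ltq1 (oner_neq0 _)) => a0.
  have m1 := monom_neq0 1%N 1 q1 (oner_neq0 _).
  rewrite negbK; apply/eqP/(bij_inj (divA m1).1).
  rewrite [LHS]qmul_monom // a0 mulr0 [RHS]qmulx0.
  by apply/ffunP => l; rewrite !ffunE if_same.
have [s sK Ks] := sigma_bij.
pose e := s (d^-1 * a^-1).
have Ud := D_unit d0; have Ua := D_unit a0.
have se : d * sigma e * a = 1.
  by rewrite Ks mulrA mulrV // mul1r mulVr.
have xe : cycA sigma q a (monom 1 d) (monom q.-1 e) = cemb q 1.
  by rewrite qmul_monom //= se.
have m0 := monom_neq0 1%N d q1 d0.
have [u [xu ux]] := inv _ m0.
have Eu : u = monom q.-1 e by apply: (bij_inj (divA m0).1); rewrite xu xe.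
have ee : e * iter q.-1 sigma d * a = 1.
  move: ux; rewrite Eu qmul_monom ?Eq1 //.
  by move/(congr1 (fun g : T => g (Ordinal q_gt0))); rewrite !ffunE.
have sdq : sigma e * iter q sigma d * a = 1.
  have := congr1 sigma ee; rewrite !rmorphM rmorph1 sa => <-.
  by rewrite -[X in iter X _ _](prednK q_gt0).
apply: (can_inj (mulrK Ua)).
have L : (d * a) * sigma e = 1 by rewrite -mulrA aC mulrA.
by rewrite -[LHS]mul1r -L -mulrA [sigma e * _]mulrA sdq mulr1.
Qed.

(** For q = 1 there is no monomial t to test sigma on, but then A consists of constants and is D
    itself; for q > 1 the modulus is central. *)
Lemma cycA_ring_axioms : ((1 < q)%N -> forall d, iter q sigma d = d) ->
  unital_ring_axioms (cycA sigma q a) (cemb q 1).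
Proof.
move=> sq; have [aC sa] := aF0.
have cE (x : T) : q = 1%N -> x = cemb q (x (Ordinal q_gt0)).
  move=> q1; apply/ffunP => i; rewrite ffunE.
  have i0 : val i = 0%N by have := ltn_ord i; rewrite /=; lia.
  by rewrite i0; congr (x _); apply: val_inj.
split.
- have [q1|q1] := leqP q 1; last exact: (qmulA_central q_gt0 aC sa (sq q1)).
  have {}q1 : q = 1%N by lia.
  move=> x y z; rewrite (cE x q1) (cE y q1) (cE z q1) /cycA.
  by rewrite !qmul_cemb // mulrA.
- by move=> x; rewrite /cycA qmul_cembl //; apply/ffunP => i; rewrite ffunE mul1r.
- move=> x; rewrite /cycA qmul_cembr //; apply/ffunP => i.
  by rewrite ffunE iter_rmorph1 mulr1.
- by move=> x y z; apply: qmulDl.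
- by move=> x y z; apply: qmulDr.
- apply/eqP => /(congr1 (fun g : T => g (Ordinal q_gt0)))/eqP.
  by rewrite !ffunE /= (negPf (oner_neq0 D)).
Qed.
End GeneralizedCyclicAlgebra.

(** * Twisted norms and the theorem *)

Section TwistedNorm.
Variables (R : nzRingType) (rho : {rmorphism R -> R}) (k : R).

Definition twnorm i := \prod_(l < i) iter l rho k.

Lemma twnormD i j : twnorm (i + j) = twnorm i * iter i rho (twnorm j).
Proof.
rewrite /twnorm big_split_ord /=; congr (_ * _).
rewrite (big_morph _ (iter_rmorphM rho i) (iter_rmorph1 rho i)).
by apply: eq_bigr => l _; rewrite iterD.
Qed.

Hypothesis rho_bij : bijective rho.
Hypothesis kC : forall x, k * x = x * k.

Lemma iter_central l x : iter l rho k * x = x * iter l rho k.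
Proof.
elim: l x => [|l IH] x /=; first exact: kC.
by have [y <-] := bij_surj x rho_bij; rewrite -!rmorphM IH.
Qed.

Lemma twnorm_central i x : twnorm i * x = x * twnorm i.
Proof.
rewrite /twnorm; elim/big_rec: _ => [|l y _ IH]; first by rewrite mul1r mulr1.
by rewrite -mulrA IH !mulrA iter_central.
Qed.

Lemma twnorm_exp s i : k ^+ s = 1 -> twnorm i ^+ s = 1.
Proof.
move=> ks; rewrite /twnorm; elim/big_rec: _ => [|l y _ IH]; first by rewrite expr1n.
rewrite exprMn_comm; last exact: iter_central.
rewrite IH mulr1 {IH}; elim: (nat_of_ord l) => //= j; rewrite -rmorphXn => ->.
by rewrite rmorph1.
Qed.

Lemma twnorm_fixed (tau : {rmorphism R -> R}) i :
  (forall x, tau (rho x) = rho (tau x)) -> tau k = k -> tau (twnorm i) = twnorm i.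
Proof.
move=> tau_rho tk; rewrite /twnorm rmorph_prod; apply: eq_bigr => l _.
by elim: (nat_of_ord l) => //= j IH; rewrite tau_rho IH.
Qed.
End TwistedNorm.

Lemma bij_of_iter (T : Type) (H : T -> T) s : (0 < s)%N ->
  (forall x, iter s H x = x) -> bijective H.
Proof.
move=> s0 Hs; exists (iter s.-1 H) => x; first by rewrite -iterSr prednK.
by rewrite -iterS prednK.
Qed.

(** The right nucleus is then everything, and 1 generates over it. *)
Lemma fin_dim_right_nucleus_assoc (T : zmodType) (mul : T -> T -> T) one :
  (forall x, mul one x = x) -> associative_alg mul -> fin_dim_right_nucleus mul.
Proof.
move=> mul1 mulA; exists 1%N, (fun=> one) => x; exists (fun=> x); split.
  by move=> _ y z; apply: mulA.
by rewrite big_ord1 mul1.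
Qed.

Lemma fin_dim_left_right_nucleus (T : zmodType) (mul : T -> T -> T) K :
  (forall z, K z -> right_nucleus mul z /\ forall x, mul z x = mul x z) ->
  fin_dim_left mul K -> fin_dim_right_nucleus mul.
Proof.
move=> KN [n [e gen]]; exists n, e => x; have [c [Kc ->]] := gen x.
exists c; split=> [i|]; first exact: (KN _ (Kc i)).1.
by apply: eq_bigr => i _; apply: (KN _ (Kc i)).2.
Qed.

Theorem theorem3p7 (D : unitRingType) (sigma : {rmorphism D -> D}) (q : nat)
  (a omega : D) (m : nat) (rho : {ffun 'I_q -> D} -> {ffun 'I_q -> D})
  (b : {ffun 'I_q -> D}) (k : D) :
  (* D is an associative division algebra, finite-dimensional over its center F *)
  (forall x : D, x != 0 -> x \is a GRing.unit) ->
  fin_dim_over_center D ->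
  (* sigma in Aut(D) *)
  bijective sigma ->
  (* sigma|_F has finite order q *)
  (0 < q)%N ->
  (forall x, central x -> iter q sigma x = x) ->
  (forall j, (0 < j < q)%N -> exists x, central x /\ iter j sigma x != x) ->
  (* a in F_0 and A = (D, sigma, a) is a division algebra *)
  inF0 sigma a ->
  division_alg (cycA sigma q a) ->
  (* omega in F_0 is a primitive q-th root of unity *)
  inF0 sigma omega -> q.-primitive_root omega ->
  (1 <= m)%N ->
  (* rho in Aut(A), b in A, 1 <> k in F_0 *)
  ring_aut (cycA sigma q a) rho ->
  inF0 sigma k -> k != 1 ->
  (* (1) *)
  (forall x, tauH sigma q omega (rho x) = rho (tauH sigma q omega x)) ->
  (* (2) *)
  tauH sigma q omega b =
    cycA sigma q a
      (\big[cycA sigma q a / cemb q (1 : D)]_(l < m) iter l rho (cemb q k)) b ->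
  (* (3) *)
  m.-primitive_root (k ^+ q) ->
  (* (4) *)
  tw_irreducible (cycA sigma q a) rho (cemb q (1 : D))
    (tw_binom (cemb q (1 : D)) m b) ->
  (* (5) *)
  associative_alg (cycB sigma q a rho m b) \/
  fin_dim_left (cycB sigma q a rho m b)
    (fun x => exists d : D, [/\ inF0 sigma d, rho (cemb q d) = cemb q d
                               & x = cemb m (cemb q d)]) \/
  fin_dim_right_nucleus (cycB sigma q a rho m b) ->
  (* conclusion: B is a nonassociative cyclic extension of D of degree mq ... *)
  nonassoc_cyclic_ext (cycB sigma q a rho m b) (cemb m (cemb q (1 : D)))
    (fun d : D => cemb m (cemb q d)) (m * q) /\
  (* ... which contains A *)
  [/\ injective (@cemb {ffun 'I_q -> D} m),
      (forall x y : {ffun 'I_q -> D}, cemb m (x + y) = cemb m x + cemb m y)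
    & (forall x y : {ffun 'I_q -> D},
         cemb m (cycA sigma q a x y) = cycB sigma q a rho m b (cemb m x) (cemb m y))].
Proof.
move=> D_unit _ sigma_bij q0 _ _ aF0 divA omF0 omP m0 [rho_bij rhoD rhoM] kF0 _
  tau_rho tau_b kP irr fd.
have one0 : cemb q (1 : D) != 0.
  apply/eqP => /(congr1 (fun g : {ffun 'I_q -> D} => g (Ordinal q0)))/eqP.
  by rewrite !ffunE /= (negPf (oner_neq0 D)).
have rho0 : rho 0 = 0 by apply: (addrI (rho 0)); rewrite -rhoD !addr0.
have two_sided x : x != 0 -> exists u, cycA sigma q a x u = cemb q 1 /\
    cycA sigma q a u x = cemb q 1.
  apply: (irreducible_two_sided_inverse _ _ divA one0 (bij_inj rho_bij) rho0 m0 irr).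
  - by move=> y; apply: qmul0x.
  - by move=> y; apply: qmulx0.
have ax : unital_ring_axioms (cycA sigma q a) (cemb q 1).
  apply: (cycA_ring_axioms q0 aF0) => q1.
  exact: (two_sided_inverse_sigma_order D_unit sigma_bij q0 aF0 divA q1 two_sided).
pose A : nzRingType := ring_of ax.
have rhoB : zmod_morphism (rho : A -> A) := morphD_zmod_morphism rhoD.
(* [ring_aut] does not mention the unit; surjectivity forces it to be fixed. *)
have rho1 : rho (cemb q 1) = cemb q 1.
  have [x x1] := bij_surj (cemb q 1 : {ffun 'I_q -> D}) rho_bij.
  by have := rhoM (cemb q 1) x; rewrite (ura_mul1 ax) x1 (ura_mulr1 ax).
have rho_mon : monoid_morphism (rho : A -> A) by split.
pose rhoA := rmorphism_of rhoB rho_mon.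
have A_inv (x : A) : x != 0 -> exists y, y * x = 1.
  by move=> /two_sided[u [_ ux]]; exists u.
have mulB1 x : cycB sigma q a rho m b (cemb m (cemb q 1)) x = x.
  apply: etrans (@qmul_cembl A rhoA m b 1 x m0) _.
  by apply/ffunP => i; rewrite ffunE mul1r.
have cembC d : inF0 sigma d -> forall x : A, (cemb q d : A) * x = x * (cemb q d : A).
  by case=> dC sd x; apply: (@qmul_fixed_centerC D sigma q a d x q0 dC sd).
have nuc : fin_dim_right_nucleus (cycB sigma q a rho m b).
  case: fd => [|[]//]; first exact: fin_dim_right_nucleus_assoc mulB1.
  apply: fin_dim_left_right_nucleus => _ [d [dF0 rd ->]]; split.
    exact: (@fixed_center_right_nucleus A rhoA m b (cemb q d) m0 (cembC d dF0) rd).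
  by move=> x; apply: (@qmul_fixed_centerC A rhoA m b (cemb q d) x m0 (cembC d dF0) rd).
have divB : division_alg (cycB sigma q a rho m b).
  exact: (@petit_division_alg A rhoA m b (bij_inj rho_bij) A_inv m0 irr nuc).
have [omC so] := omF0.
have om_norm i : twnorm sigma omega i = omega ^+ i.
  rewrite /twnorm -[i in RHS]card_ord -prodr_const; apply: eq_bigr => l _.
  by elim: (nat_of_ord l) => //= j ->.
have tauE x (i : 'I_q) : tauH sigma q omega x i = x i * omega ^+ i.
  by rewrite ffunE -om_norm.
(* As sigma fixes omega, the cocycle is omega^i, and omega^q = 1 is what preserves t^q - a. *)
have tauM : {morph tauH sigma q omega : x y / cycA sigma q a x y}.
  apply: (@twistM D sigma q a idfun (twnorm sigma omega)) => //.
  - exact: twnorm_central.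
  - exact: twnormD.
  - by rewrite om_norm (prim_expr_order omP) mul1r.
have tauD : {morph tauH sigma q omega : x y / x + y}.
  exact: (@twistD D q idfun (twnorm sigma omega)).
have tau_cemb d : tauH sigma q omega (cemb q d) = cemb q d.
  apply/ffunP => i; rewrite tauE ffunE.
  by case: eqP => [->|]; rewrite ?mulr1 ?mul0r.
have tau_mon : monoid_morphism (tauH sigma q omega : A -> A).
  by split; [apply: tau_cemb | apply: tauM].
have tauB : zmod_morphism (tauH sigma q omega : A -> A) :=
  morphD_zmod_morphism tauD.
pose tauA := rmorphism_of tauB tau_mon.
pose N := twnorm rhoA (cemb q k : A).
have kC := cembC k kF0.
have NC := twnorm_central (rho_bij : bijective rhoA) kC : forall i x, N i * x = x * N i.
have tauN i : tauA (N i) = N i.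
  exact: (twnorm_fixed i (tau_rho : forall x, tauA (rhoA x) = rhoA (tauA x)) (tau_cemb k)).
(* Condition (1) gives the commutation with rho, and condition (2) reads tau(b) = N_m b. *)
pose H : {ffun 'I_m -> A} -> {ffun 'I_m -> A} := twist tauA N.
have HM : {morph H : x y / cycB sigma q a rho m b x y}.
  apply: (@twistM A rhoA m b tauA N) => //.
  exact: twnormD.
have HD : {morph H : x y / x + y} by apply: twistD.
have iterH j g (i : 'I_m) : iter j H g i = iter j tauA (g i) * N i ^+ j.
  by rewrite /H iter_twist // ffunE.
have iter_tau j (x : {ffun 'I_q -> D}) (v : 'I_q) :
    iter j (tauH sigma q omega) x v = x v * omega ^+ (v * j).
  elim: j => [|j IH]; first by rewrite muln0 mulr1.
  by rewrite iterS tauE IH -mulrA -exprD mulnS addnC.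
have kX j : (cemb q k : A) ^+ j = cemb q (k ^+ j).
  elim: j => [|j IH]; first by rewrite !expr0.
  by rewrite !exprS IH; apply: (@qmul_cemb D sigma q a).
have s0 : (0 < m * q)%N by rewrite muln_gt0 m0.
(* On the coefficients tau has order dividing q, while the factors N_i vanish from the power because
   k^(mq) = (k^q)^m = 1. *)
have Hs x : iter (m * q) H x = x.
  apply/ffunP => i; rewrite iterH [N i ^+ _]twnorm_exp.
  - rewrite mulr1; apply/ffunP => v; rewrite iter_tau mulnA mulnC exprM.
    by rewrite (prim_expr_order omP) expr1n mulr1.
  - exact: rho_bij.
  - exact: kC.
  - by rewrite kX mulnC exprM (prim_expr_order kP).
have emb_mul d x (u : 'I_m) (v : 'I_q) :
    cycB sigma q a rho m b (cemb m (cemb q d)) x u v = d * x u v.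
  have -> : cycB sigma q a rho m b (cemb m (cemb q d)) x u =
      cycA sigma q a (cemb q d) (x u).
    exact: (@qmul_cembl_ord A rhoA m b (cemb q d) x u m0).
  exact: qmul_cembl_ord.
have addE (f g : {ffun 'I_m -> {ffun 'I_q -> D}}) u v : (f + g) u v = f u v + g u v.
  by rewrite !ffunE.
have embB_M x y : cemb m (cycA sigma q a x y) =
    cycB sigma q a rho m b (cemb m x) (cemb m y).
  by apply: esym; apply: (@qmul_cemb A rhoA m b x y m0).
have embA_M d d' : cemb q (d * d') = cycA sigma q a (cemb q d) (cemb q d').
  by apply: esym; apply: qmul_cemb.
split; last by split; [exact: cemb_inj | exact: cembD | exact: embB_M].
split=> //.
- split=> //; first by move=> d d' /(cemb_inj m0)/(cemb_inj q0).
  + by move=> d d'; rewrite !cembD.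
  + by move=> d d'; rewrite embA_M embB_M.
- split=> //.
  + move=> d d' x; apply/ffunP => u; apply/ffunP => v.
    by rewrite emb_mul [RHS]emb_mul emb_mul mulrA.
  + move=> d x y; apply/ffunP => u; apply/ffunP => v.
    by rewrite [LHS]emb_mul addE mulrDr [RHS]addE 2!emb_mul.
  + move=> d d' x; apply/ffunP => u; apply/ffunP => v.
    by rewrite [LHS]emb_mul mulrDl [RHS]addE 2!emb_mul.
(* Index u q + v stands for the monomial with exponent v in A and exponent u in B. *)
- pose e (i : 'I_(m * q)) : {ffun 'I_m -> {ffun 'I_q -> D}} :=
    [ffun u : 'I_m => [ffun v : 'I_q => (val i == u * q + v)%N%:R]].
  have idx_lt (u : 'I_m) (v : 'I_q) : (u * q + v < m * q)%N.
    have := ltn_ord u; have := ltn_ord v; nia.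
  pose idx u v := Ordinal (idx_lt u v).
  have sumE (c : 'I_(m * q) -> D) u v :
      (\sum_i cycB sigma q a rho m b (cemb m (cemb q (c i))) (e i)) u v = c (idx u v).
    rewrite !sum_ffunE (bigD1 (idx u v)) //= big1 => [|i ni].
      by rewrite emb_mul !ffunE eqxx mulr1 addr0.
    by rewrite emb_mul !ffunE (negPf (_ : val i != (u * q + v)%N)) ?mulr0.
  have idx_surj i : exists u v, i = idx u v.
    have ltu : (i %/ q < m)%N by rewrite ltn_divLR.
    exists (Ordinal ltu), (Ordinal (ltn_pmod i q0)).
    by apply: val_inj; rewrite /= -divn_eq.
  exists e; split=> [x|c c0 i].
    (* The default 0 is never reached, since i / q < m and i mod q < q. *)
    pose c (i : 'I_(m * q)) :=
      oapp (fun u => oapp (x u) 0 (insub (i %% q)%N)) 0 (insub (i %/ q)%N).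
    exists c; apply/ffunP => u; apply/ffunP => v; rewrite sumE /c /=.
    by rewrite divnMDl // divn_small // addn0 modnMDl modn_small // !valK.
  by have [u [v ->]] := idx_surj i; rewrite -sumE c0 !ffunE.
exists H; split=> //.
- by split; [exact: bij_of_iter s0 Hs | exact: HD | exact: HM].
- move=> j /andP[j0 ltj].
  (* If q does not divide j, the generator t of A is moved: it is multiplied by omega^j. *)
  have [qj|nqj] := boolP (q %| j)%N; last first.
    have q1 : (1 < q)%N.
      by rewrite ltn_neqAle q0 andbT; apply: contraNneq nqj => <-; rewrite dvd1n.
    exists (cemb m (monom q 1 1)); apply: contraNneq nqj.
    move/(congr1 (fun g : {ffun 'I_m -> {ffun 'I_q -> D}} =>
      g (Ordinal m0) (Ordinal q1))).
    have -> : iter j H (cemb m (monom q 1 1)) (Ordinal m0) =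
        iter j (tauH sigma q omega) (monom q 1 1).
      by rewrite iterH /N /twnorm big_ord0 expr1n mulr1 ffunE.
    rewrite iter_tau !ffunE /=.
    by rewrite mul1r mul1n (prim_order_dvd omP) => ->.
  (* If q divides j, then j < mq leaves room for the generator t of B over A, which is multiplied by
     N_1^j = k^j. *)
  have m1 : (1 < m)%N.
    rewrite ltn_neqAle m0 andbT; apply: contraTneq ltj => <-.
    by rewrite mul1n -leqNgt dvdn_leq.
  exists [ffun u : 'I_m => if val u == 1%N then cemb q 1 else 0]; apply/eqP.
  move/(congr1 (fun g : {ffun 'I_m -> {ffun 'I_q -> D}} => g (Ordinal m1))).
  rewrite iterH ffunE /= /N /twnorm big_ord1 /= kX.
  have -> : iter j tauA (cemb q 1) = 1 by elim: j {j0 ltj qj} => //= j ->; apply: tau_cemb.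
  rewrite mul1r => /(cemb_inj q0) kj1.
  (* With j = i q, k^j = (k^q)^i = 1 forces m to divide i, hence mq to divide j, against j < mq. *)
  have [i Ej] := dvdnP qj.
  have : (m %| i)%N by rewrite (prim_order_dvd kP) -exprM mulnC -Ej kj1.
  move/(dvdn_mul (dvdnn q)); rewrite mulnC [X in (_ %| X)%N]mulnC -Ej.
  by move/(dvdn_leq j0); rewrite leqNgt ltj.
- move=> d; apply/ffunP => i; rewrite !ffunE; case: eqP => [->|_].
    by rewrite /N /twnorm big_ord0 mulr1; apply: tau_cemb.
  by rewrite rmorph0 mul0r.
Qed.
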